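(* Let $G$ be a finite simple graph with at least one vertex, with chromatic number $\chi(G)$ and with $\alpha(G)$ the cardinality of a maximum independent set of $G$. Then $$\mathrm{cub}(G) \le 2 \lceil \log_2 \chi(G) \rceil \, \mathrm{box}(G) + \chi(G) \lceil \log_2 \alpha(G) \rceil .$$
   Context: An axis-parallel $k$-dimensional box ($k$-box) is a Cartesian product $R_1\times\cdots\times R_k$ of closed intervals $R_i=[a_i,b_i]$ of the real line; a $k$-unit-cube ($k$-cube) is a $k$-box in which each $R_i$ has the form $[a_i,a_i+1]$. A $k$-box representation (respectively $k$-cube representation) of a graph $G$ is a map $f$ from $V(G)$ to $k$-boxes (respectively $k$-cubes) such that for any two distinct vertices $u,v$, $(u,v)\in E(G)$ if and only if $f(u)\cap f(v)\neq\emptyset$. The boxicity $\mathrm{box}(G)$ (respectively cubicity $\mathrm{cub}(G)$) is the minimum non-negative integer $k$ such that $G$ has a $k$-box representation (respectively $k$-cube representation). By convention, the graphs with boxicity (cubicity) $0$ are exactly the complete graphs. *)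

(* Defs.v *)
From HB Require Import structures.
From mathcomp Require Import all_boot all_order all_algebra.
From mathcomp Require Import boolp classical_sets set_interval reals.

Set Implicit Arguments.
Unset Strict Implicit.
Unset Printing Implicit Defensive.

Import Order.TTheory GRing.Theory Num.Theory.

Local Open Scope classical_set_scope.
Local Open Scope ring_scope.

Record sgraph := SGraph {
  vertex :> finType;
  edge : rel vertex;
  edge_sym : symmetric edge;
  edge_irr : irreflexive edge }.

Arguments edge {s}.

Section BoxesAndCubes.
Variables (R : realType) (k : nat).

Definition box_set (a b : 'I_k -> R) : set 'rV[R]_k :=
  [set x : 'rV[R]_k | forall i, x ord0 i \in `[a i, b i]].

(* Without [a i <= b i] the empty set would count as a box. *)
Definition is_box (B : set 'rV[R]_k) : Prop :=
  exists a b : 'I_k -> R, (forall i, a i <= b i) /\ B = box_set a b.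

Definition is_cube (B : set 'rV[R]_k) : Prop :=
  exists a : 'I_k -> R, B = box_set a (fun i => a i + 1).

Definition intersection_rep (G : sgraph) (f : G -> set 'rV[R]_k) : Prop :=
  forall u v : G, u != v -> (edge u v <-> f u `&` f v !=set0).

Definition box_representation (G : sgraph) (f : G -> set 'rV[R]_k) : Prop :=
  (forall v, is_box (f v)) /\ intersection_rep f.

Definition cube_representation (G : sgraph) (f : G -> set 'rV[R]_k) : Prop :=
  (forall v, is_cube (f v)) /\ intersection_rep f.

End BoxesAndCubes.

Definition has_box_representation (R : realType) (G : sgraph) (k : nat) : bool :=
  `[< exists f : G -> set 'rV[R]_k, box_representation f >].

Definition has_cube_representation (R : realType) (G : sgraph) (k : nat) : bool :=
  `[< exists f : G -> set 'rV[R]_k, cube_representation f >].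

(* One coordinate per vertex w: w itself is placed at [0, 1], its neighbours
   at [1, 2] and all other vertices at [2, 3]. *)
Lemma ex_cube_representation (R : realType) (G : sgraph) :
  exists k, has_cube_representation R G k.
Proof.
exists #|G|; apply/asboolP.
pose p (v : G) (i : 'I_#|G|) : R :=
  if v == enum_val i then 0 else if edge (enum_val i) v then 1 else 2.
exists (fun v => box_set (p v) (fun i => p v i + 1)); split.
  by move=> v; exists (p v).
move=> u v uv; split=> [euv|[x [xu xv]]].
  exists (\row_i Num.max (p u i) (p v i)).
  suff H i : p u i <= p v i + 1 /\ p v i <= p u i + 1.
    by split=> i /=; have [? ?] := H i;
      rewrite mxE in_itv /= le_max ge_max !lexx ?orbT /= ?lerDl ?ler01 ?andbT.
  have h12 : (1 : R) <= 2 by rewrite ler1n.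
  have h02 : (0 : R) <= 2 by rewrite ler0n.
  have h01 : (0 : R) <= 1 by rewrite ler01.
  have e2 : (1 + 1 : R) = 2 by [].
  have h13 : (1 : R) <= 2 + 1 by rewrite lerDr ler0n.
  rewrite /p; move: (enum_val i) => w.
  have [<-|_] := eqVneq u w.
    by rewrite [v == u]eq_sym (negPf uv) euv add0r e2 lexx h02.
  have [<-|_] := eqVneq v w; first by rewrite edge_sym euv add0r e2 lexx h02.
  by case: (edge w u); case: (edge w v); rewrite ?e2 ?lerDl ?h01 ?lexx ?h13.
have := xu (enum_rank u); have := xv (enum_rank u).
rewrite /= !in_itv /= /p enum_rankK eqxx eq_sym (negPf uv).
case: (edge u v) => // /andP[l2 _] /andP[_]; rewrite add0r => g1.
by have := le_trans l2 g1; rewrite lern1.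
Qed.

Lemma ex_box_representation (R : realType) (G : sgraph) :
  exists k, has_box_representation R G k.
Proof.
have [k /asboolP[f [cf rf]]] := ex_cube_representation R G.
exists k; apply/asboolP; exists f; split=> // v; have [a ->] := cf v.
by exists a, (fun i => a i + 1); split=> // i; rewrite lerDl ler01.
Qed.

Definition boxicity (R : realType) (G : sgraph) : nat :=
  ex_minn (ex_box_representation R G).

Definition cubicity (R : realType) (G : sgraph) : nat :=
  ex_minn (ex_cube_representation R G).

Definition proper_coloring (G : sgraph) (k : nat) (c : {ffun G -> 'I_k}) : bool :=
  [forall u, forall v, edge u v ==> (c u != c v)].

Definition colorable (G : sgraph) (k : nat) : bool :=
  [exists c : {ffun G -> 'I_k}, proper_coloring c].

Lemma ex_colorable (G : sgraph) : exists k, colorable G k.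
Proof.
exists #|G|; apply/existsP; exists [ffun v => enum_rank v].
apply/forallP=> u; apply/forallP=> v; apply/implyP=> euv; rewrite !ffunE.
by apply: contraTneq euv => /enum_rank_inj ->; rewrite edge_irr.
Qed.

Definition chromatic_number (G : sgraph) : nat := ex_minn (ex_colorable G).

Definition independent (G : sgraph) (A : {set G}) : bool :=
  [forall u in A, forall v in A, ~~ edge u v].

Definition independence_number (G : sgraph) : nat :=
  \max_(A : {set G} | independent A) #|A|.

(* Main.v *)
Require Import Defs.
From mathcomp Require Import all_boot all_order all_algebra.
From mathcomp Require Import boolp classical_sets set_interval reals.
From mathcomp Require Import lra.

(** A [k]-cube representation amounts to [k] real labellings [p _ j] of the
    vertices such that distinct [u], [v] are adjacent exactly when
    [`|p u j - p v j| <= 1] for every [j] ([cubicity_le]).  So it suffices to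
    exhibit the right number of labellings, none of which separates (puts at
    distance more than [1]) an edge, and such that every non-edge is separated
    by at least one of them.

    Fix a colouring with [chi] colours.  Two distinct vertices of the same
    colour are never adjacent, so inside a colour class everything can be
    separated: give the members of the class distinct binary codes of length
    [up_log 2 alpha], and for each bit put the members with bit [0] at [0],
    those with bit [1] at [2], and all other vertices at [1]
    ([class_coord]).  This takes [chi * up_log 2 alpha] labellings.

    Non-adjacent vertices of different colours are separated in some coordinate
    [[l u, r u]], [[l v, r v]] of an optimal box representation, and by some
    bit of a binary code of the colours, of length [up_log 2 chi].  A bit splits
    the vertices into two sides.  Once all end points are scaled into
    [[0, 1]], label the vertices of one side by [l] and those of the other by
    [r - 1] ([cross_coord]).  Each side lies within an interval of length [1],
    so nothing is separated there, while across the sides the unit condition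
    says exactly that the left end point of the one does not exceed the right
    end point of the other.  Exchanging the two sides gives the other
    inequality, whence the factor [2]. *)

Set Implicit Arguments.
Unset Strict Implicit.
Unset Printing Implicit Defensive.

Import Order.TTheory GRing.Theory Num.Theory.

Local Open Scope ring_scope.

(** Intervals have the Helly property, trivially here: two of them that overlap
    share the larger of their left end points, so boxes meet as soon as they
    overlap in each coordinate. *)
Lemma box_set_meet (R : realType) (k : nat) (a b c d : 'I_k -> R) :
  (forall i, a i <= b i) -> (forall i, c i <= d i) ->
  (box_set a b `&` box_set c d !=set0)%classic <->
  (forall i, a i <= d i /\ c i <= b i).
Proof.
move=> ab cd; split=> [[x [xab xcd]] i|H].
  have := xab i; have := xcd i; rewrite /= !in_itv /= => /andP[? ?] /andP[? ?].
  by split; lra.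
exists (\row_i Num.max (a i) (c i)).
by split=> i /=; have [? ?] := H i; have := ab i; have := cd i;
  rewrite mxE in_itv /= le_max ge_max !lexx ?orbT /= => *; apply/andP.
Qed.

(** Coordinates may be indexed by any finite type, so that the final bound is
    read off as the cardinal of the index type. *)
Lemma cubicity_le (R : realType) (G : sgraph) (J : finType) (p : G -> J -> R) :
  (forall u v : G, u != v -> edge u v <-> forall j, `|p u j - p v j| <= 1) ->
  (cubicity R G <= #|J|)%N.
Proof.
move=> Hp; rewrite /cubicity; case: ex_minnP => m _; apply; apply/asboolP.
exists (fun v => box_set (fun j => p v (enum_val j))
                         (fun j => p v (enum_val j) + 1)); split.
  by move=> v; exists (fun j => p v (enum_val j)).
move=> u v uv; rewrite Hp //.
rewrite box_set_meet; [|by move=> i; rewrite lerDl ler01..].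
split=> H j.
  by have := H (enum_val j); rewrite ler_norml => /andP[? ?]; split; lra.
have [] := H (enum_rank j); rewrite enum_rankK => ? ?.
by rewrite ler_norml; apply/andP; split; lra.
Qed.

Lemma finite_bound (R : realType) (T : finType) (f : T -> R) :
  exists2 M : R, 0 < M & forall t, `|f t| <= M.
Proof.
exists (1 + \sum_t `|f t|).
  by rewrite ltr_pwDl ?ltr01 // sumr_ge0.
move=> t; rewrite (bigD1 t) //= addrCA lerDl addr_ge0 ?ler01 //.
exact: sumr_ge0.
Qed.

(** Only the order of the end points matters, so an increasing affine map
    brings them all into the unit interval. *)
Lemma boxicity_intervals (R : realType) (G : sgraph) :
  exists l r : G -> 'I_(boxicity R G) -> R,
    (forall v i, 0 <= l v i /\ l v i <= r v i /\ r v i <= 1) /\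
    (forall u v : G, u != v ->
       edge u v <-> forall i, l u i <= r v i /\ l v i <= r u i).
Proof.
rewrite /boxicity; case: ex_minnP => k /asboolP[f [/choice[a fa] rf]] _.
have [b fb] := choice fa.
have [M M0 HM] := finite_bound (fun t : G * 'I_k => `|a t.1 t.2| + `|b t.1 t.2|).
have scale x y : ((x + M) / (M *+ 2) <= (y + M) / (M *+ 2)) = (x <= y).
  by rewrite ler_pM2r ?lerD2r // invr_gt0 pmulrn_lgt0.
have bnd v i : - M <= a v i /\ b v i <= M.
  have := HM (v, i) => /=; rewrite ger0_norm ?addr_ge0 // => H.
  have := lerNnormlW (lexx `|a v i|); have := ler_norm (b v i).
  have := normr_ge0 (a v i); have := normr_ge0 (b v i).
  by move=> *; split; lra.
exists (fun v i => (a v i + M) / (M *+ 2)), (fun v i => (b v i + M) / (M *+ 2)).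
split=> [v i|u v uv].
  have [? ?] := bnd v i; have [ab _] := fb v; split; last split.
  - by rewrite divr_ge0 ?mulrn_wge0 ?(ltW M0) //; lra.
  - by rewrite scale.
  - by rewrite ler_pdivrMr ?pmulrn_lgt0 // mul1r mulr2n; lra.
rewrite rf //; have [abu ->] := fb u; have [abv ->] := fb v.
rewrite box_set_meet //.
by split=> H i; have := H i; rewrite !scale.
Qed.

(** The [n]-th member of [A] gets the [n]-th word of length [k], in arbitrary
    enumerations.  The default word is reached only outside [A] or when [A] has
    more than [2 ^ k] members. *)
Definition code (T : finType) (k : nat) (A : {set T}) (x : T) :
  {ffun 'I_k -> bool} :=
  nth [ffun=> false] (enum {: {ffun 'I_k -> bool}}) (index x (enum A)).

Lemma code_inj (T : finType) (k : nat) (A : {set T}) :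
  (#|A| <= 2 ^ k)%N -> {in A &, injective (@code T k A)}.
Proof.
move=> Ak x y xA yA /eqP.
have lt z : z \in A -> (index z (enum A) < size (enum {: {ffun 'I_k -> bool}}))%N.
  move=> zA; rewrite -cardE card_ffun card_bool card_ord.
  by apply: leq_trans Ak; rewrite cardE index_mem mem_enum.
rewrite nth_uniq ?enum_uniq ?lt // => /eqP.
by apply: (index_inj x); rewrite mem_enum.
Qed.

Lemma code_neq (T : finType) (k : nat) (A : {set T}) (x y : T) :
  (#|A| <= 2 ^ k)%N -> x \in A -> y \in A -> x != y ->
  exists b, code k A x b != code k A y b.
Proof.
move=> Ak xA yA xy; apply/existsP; apply: contraNT xy.
rewrite negb_exists => /forallP H; apply/eqP; apply: (code_inj Ak) => //.
by apply/ffunP=> b; apply/eqP; rewrite -[_ == _]negbK H.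
Qed.

Lemma optimal_coloring (G : sgraph) :
  exists c : G -> 'I_(chromatic_number G), forall u v, edge u v -> c u != c v.
Proof.
rewrite /chromatic_number; case: ex_minnP => k /existsP[c /forallP H] _.
by exists c => u v; have /forallP/(_ v)/implyP := H u.
Qed.

(** Colour classes are independent sets, which is where [alpha] enters. *)
Lemma color_class_card (G : sgraph) (C : finType) (c : G -> C) (i : C) :
  (forall u v, edge u v -> c u != c v) ->
  (#|[set v | c v == i]| <= 2 ^ up_log 2 (independence_number G))%N.
Proof.
move=> cP; apply: leq_trans (up_logP _ _) => //.
apply: (leq_bigmax_cond (F := fun A : {set G} => #|A|)); apply/forall_inP=> u; rewrite inE => /eqP cu.
apply/forall_inP=> v; rewrite inE => /eqP cv.
by apply/negP=> /cP; rewrite cu cv eqxx.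
Qed.

Section Coordinates.
Variables (R : realType) (V : finType).

Definition cross_coord (side : V -> bool) (l r : V -> R) (v : V) : R :=
  if side v then l v else r v - 1.

Definition class_coord (A : {set V}) (bit : V -> bool) (v : V) : R :=
  if v \in A then (if bit v then 2 else 0) else 1.

(** The bounds [0] and [1] on the end points are needed twice: they keep two
    vertices of the same side within distance [1], and across the sides they
    make the other half of the unit condition, [r v - 1 <= l u + 1],
    automatic. *)
Lemma cross_coord_close (side : V -> bool) (l r : V -> R) (u v : V) :
  (forall w, 0 <= l w /\ l w <= r w /\ r w <= 1) ->
  l u <= r v -> l v <= r u ->
  `|cross_coord side l r u - cross_coord side l r v| <= 1.
Proof.
move=> lr uv vu; have [? [? ?]] := lr u; have [? [? ?]] := lr v.
by rewrite /cross_coord ler_norml; case: (side u); case: (side v);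
  apply/andP; split; lra.
Qed.

Lemma cross_coord_far (side : V -> bool) (l r : V -> R) (u v : V) :
  side u -> ~~ side v ->
  `|cross_coord side l r u - cross_coord side l r v| <= 1 -> l u <= r v.
Proof.
move=> su /negbTE sv; rewrite /cross_coord su sv ler_norml => /andP[_ ?]; lra.
Qed.

(** A vertex outside [A] sits at [1], within reach of both [0] and [2], so only
    pairs inside [A], which are non-edges when [A] is independent, can be
    separated. *)
Lemma class_coord_close (A : {set V}) (bit : V -> bool) (u v : V) :
  ~~ ((u \in A) && (v \in A)) ->
  `|class_coord A bit u - class_coord A bit v| <= 1.
Proof.
rewrite /class_coord ler_norml.
by case: (u \in A); case: (v \in A) => // _; case: (bit u); case: (bit v);
  apply/andP; split; lra.
Qed.

Lemma class_coord_far (A : {set V}) (bit : V -> bool) (u v : V) :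
  u \in A -> v \in A -> bit u != bit v ->
  1 < `|class_coord A bit u - class_coord A bit v|.
Proof.
rewrite /class_coord => -> ->.
case: (bit u); case: (bit v) => // _.
  by rewrite subr0 ger0_norm ?ler0n // ltr1n.
by rewrite sub0r normrN ger0_norm ?ler0n // ltr1n.
Qed.

End Coordinates.

Theorem theorem3 (R : realType) (G : sgraph) (G_gt0 : (0 < #|G|)%N) :
  (cubicity R G <=
     2 * up_log 2 (chromatic_number G) * boxicity R G
       + chromatic_number G * up_log 2 (independence_number G))%N.
Proof.
have [c cP] := optimal_coloring G.
have [l [r [lr edgeE]]] := boxicity_intervals R G.
set chi := chromatic_number G in c cP *.
set m := up_log 2 (independence_number G).
pose colbit v := code (up_log 2 chi) [set: 'I_chi] (c v).
pose cls i := [set v | c v == i].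
(* In [(d, b, i)] the boolean [d] exchanges the two sides given by bit [b]. *)
pose J : finType :=
  ((bool * 'I_(up_log 2 chi) * 'I_(boxicity R G)) + ('I_chi * 'I_m))%type.
pose p (v : G) (j : J) : R := match j with
  | inl (d, b, i) => cross_coord (fun w => colbit w b (+) d)
                                 (fun w => l w i) (fun w => r w i) v
  | inr (i, b) => class_coord R (cls i) (fun w => code m (cls i) w b) v
  end.
suff /cubicity_le :
    forall u v, u != v -> edge u v <-> forall j, `|p u j - p v j| <= 1.
  by rewrite card_sum !card_prod card_bool !card_ord.
move=> u v uv; split=> [euv [[[d b] i]|[i b]]|close].
- have [? ?] := (edgeE u v uv).1 euv i.
  by apply: cross_coord_close => // w; exact: lr.
- apply: class_coord_close; rewrite !inE.
  by apply: contra (cP _ _ euv) => /andP[/eqP-> /eqP->].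
have [cuv|cuv] := eqVneq (c u) (c v).
  have uA : u \in cls (c v) by rewrite inE cuv.
  have vA : v \in cls (c v) by rewrite inE.
  have [b bP] := code_neq (color_class_card (c v) cP) uA vA uv.
  have := class_coord_far R (bit := fun w => code m (cls (c v)) w b) uA vA bP.
  by rewrite ltNge (close (inr (c v, b))).
have [b bP] : exists b, colbit u b != colbit v b.
  by apply: code_neq; rewrite ?inE // cardsT card_ord up_logP.
(* With [d := ~~ colbit u b] the vertex [u] is on the side labelled by [l] and
   [v] on the one labelled by [r - 1]; with [d := colbit u b] it is the
   reverse. *)
apply/edgeE => // i.
split.
  apply: (cross_coord_far _ _ (close (inl (~~ colbit u b, b, i)))).
    by case: (colbit u b).
  by case: (colbit u b) (colbit v b) bP => [] [].
have := close (inl (colbit u b, b, i)); rewrite distrC; apply: cross_coord_far.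
  by case: (colbit u b) (colbit v b) bP => [] [].
by case: (colbit u b).
Qed.
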